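(* Let $G$ be a $2$-connected unit interval graph with $|V(G)|\ge 3$, and let $v_1,v_2,\ldots,v_n$ be a unit interval order of its vertices. Then there exists a $2$-connected unit interval graph $G^*$ such that every two distinct maximal cliques of $G^*$ with nonempty intersection have at least two common vertices and $$\tau(G)=\tau(G^* )=\mathrm{diam}(G^* ).$$ Besides, $\tau(G)=\tau_G(\{v_1,v_2\})=\tau_G(\{v_{n-1},v_n\})$.
   Context: Graphs are finite, simple and undirected. A unit interval graph is the intersection graph of a finite family of closed unit-length intervals of the real line; equivalently, a graph admitting a linear order of its vertices (a unit interval order) such that the closed neighborhood of each vertex is a set of consecutive vertices. Percolation: for $S\subseteq V(G)$ let $I[S]$ be $S$ together with all vertices having at least two neighbors in $S$; let $I^0[S]=S$ and $I^{k+1}[S]=I[I^k[S]]$. $S$ is a hull set if $I^k[S]=V(G)$ for some $k$, and then $\tau_G(S)$ (also written $\tau_S(G)$) is the minimum such $k$. The percolation time is $\tau(G)=\max\{\tau_S(G): S \text{ is a hull set of } G\}$. $\mathrm{diam}$ is the diameter. *)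

(* Defs.v *)
From HB Require Import structures.
From mathcomp Require Import all_boot all_order all_algebra.
From mathcomp Require Import boolp reals.

Set Implicit Arguments.
Unset Strict Implicit.
Unset Printing Implicit Defensive.

Record sgraph := SGraph {
  vertex :> finType;
  edge : rel vertex;
  edge_sym : symmetric edge;
  edge_irrefl : irreflexive edge }.

Notation "x -- y" := (edge x y) (at level 30).

Section Graph.
Variable G : sgraph.
Implicit Types (x y u v : G) (A S : {set G}).

Definition cl_nbh x : {set G} := [set y | (y == x) || x -- y].

Definition clique A : bool := [forall u in A, forall v in A, (u != v) ==> u -- v].

(* The subgraph of G induced by A is connected. *)
Definition connected_on A : bool :=
  [forall u in A, forall v in A,
     connect [rel a b | [&& a \in A, b \in A & a -- b]] u v].

Definition two_connected : bool :=
  [&& 2 < #|G|, connected_on [set: G] & [forall x, connected_on [set~ x]]].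

Definition walk_of_length u v (k : nat) : bool :=
  [exists p : k.-tuple G, path (@edge G) u p && (last u p == v)].

(* The value 0 for vertices in different components is junk: dist and diam
   are only meaningful for connected graphs. *)
Definition dist u v : nat :=
  if pselect (exists k, walk_of_length u v k) is left h then ex_minn h else 0.

Definition diam : nat := \max_(u : G) \max_(v : G) dist u v.

Definition perc_step S : {set G} :=
  S :|: [set v | 2 <= #|[set u in S | u -- v]|].

Definition percolates_by S (k : nat) : bool := iter k perc_step S == [set: G].

Definition hull_set S : Prop := exists k, percolates_by S k.

(* The value 0 is junk when S is not a hull set. *)
Definition perc_time_of S : nat :=
  if pselect (hull_set S) is left h then ex_minn h else 0.

Definition perc_time : nat :=
  \max_(S : {set G} | `[< hull_set S >]) perc_time_of S.

(* In a duplicate-free enumeration s, the members of a set are consecutive iff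
   the subsequence of s that they form is a contiguous block of s. *)
Definition unit_interval_order (s : seq G) : Prop :=
  [/\ uniq s, s =i G &
      forall x, infix [seq y <- s | y \in cl_nbh x] s].

Local Open Scope ring_scope.

(* The interval of the vertex u is [f u, f u + 1]; distinct vertices may be
   represented by the same interval. *)
Definition unit_interval_graph (R : realType) : Prop :=
  exists f : G -> R, forall u v : G,
    u -- v <->
    u <> v /\ exists t : R, t \in `[f u, f u + 1] /\ t \in `[f v, f v + 1].

End Graph.

Arguments two_connected : clear implicits.
Arguments diam : clear implicits.
Arguments perc_time : clear implicits.
Arguments unit_interval_graph : clear implicits.

(* Main.v *)
Require Import Defs.
From mathcomp Require Import all_boot all_order all_algebra.
From mathcomp Require Import boolp reals.
From mathcomp Require Import zify.

Set Implicit Arguments.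
Unset Strict Implicit.
Unset Printing Implicit Defensive.

Import Order.TTheory GRing.Theory Num.Theory.

(** The proof works with a numbering [pos] of the vertices in which an edge
    turns everything it spans into a clique.  2-connectivity makes vertices at
    distance at most two in the numbering adjacent, for otherwise the vertex
    between them would be a cut vertex.

    Let E be the set of the first two vertices, F that of the last two, and let
    E_t, F_t, S_t be the sets infected after t steps from E, F and a hull set S.
    If at some time S_t contains two consecutive vertices c, c+1 and everything
    of E_t from c on to the right, this persists forever ([perc_right_mono]):
    an edge that brings infection to E_t from the
    left of c spans c and c+1, so S_t profits from them.

    A hull set S other than the whole vertex set contains two vertices a < b
    with a common neighbour v ([hull_set_seed]).  If a and b are adjacent, S_t
    overtakes E_t at the right of a at time 1 ([adjacent_seed]); if not, v lies
    between them and S_t contains E_t at the right of v from time 1 on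
    ([nonadjacent_seed]).  Reversing the numbering, S_t contains F_t at the left
    of b, respectively v.  So S has percolated as soon as both E and F have.

    Finally E and F need the same time.  The right end of the infected interval
    moves by m -> r(m-1) and the left end by m -> l(m+1), where r and l give the
    extreme neighbours; for i <= j, r(i) >= j exactly if l(j) <= i, so up
    to a shift by one the two maps are adjoint and their iterates reach the opposite ends together
    ([perc_duality]).  Hence E is a slowest hull set, and by symmetry F too.

    For the graph G* only the number k = tau(G) > 0 matters.  Replace each vertex
    of a path with k edges by two adjacent twins: the maximal cliques are unions
    of twin pairs, the diameter is k, and infection from the first pair advances
    by one pair per step, so that the percolation time is k by the result above
    applied to G* itself. *)

(** * Percolation in arbitrary graphs *)

Section Percolation.
Variable G : sgraph.
Implicit Types (x y z u v : G) (S : {set G}).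

Definition perc S t : {set G} := iter t (@perc_step G) S.

Lemma percS S t : perc S t.+1 = perc_step (perc S t).
Proof. by []. Qed.

Lemma percSr S t : perc S t.+1 = perc (perc_step S) t.
Proof. by rewrite /perc iterSr. Qed.

Lemma perc_stepP S x :
  reflect (x \in S \/ exists u v, [/\ u \in S, v \in S, u != v, x -- u & x -- v])
          (x \in perc_step S).
Proof.
rewrite !inE; apply: (iffP orP) => -[xS|]; [by left | | by left | ].
  case/card_gt1P=> u [v [+ + uv]]; rewrite !inE => /andP[uS ux] /andP[vS vx].
  by right; exists u, v; split; rewrite // edge_sym.
case=> u [v [uS vS uv xu xv]]; right; apply/card_gt1P; exists u, v.
by rewrite !inE uS vS !(edge_sym _ x) xu xv.
Qed.

Lemma perc_step_pair S x u v :
  u \in S -> v \in S -> u != v -> x -- u -> x -- v -> x \in perc_step S.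
Proof. by move=> uS vS uv xu xv; apply/perc_stepP; right; exists u, v. Qed.

Lemma perc_sub_step S : S \subset perc_step S.
Proof. exact: subsetUl. Qed.

Lemma mem_percS S t x : x \in perc S t -> x \in perc S t.+1.
Proof. exact/subsetP/perc_sub_step. Qed.

Lemma mem_perc S t x : x \in S -> x \in perc S t.
Proof. by move=> xS; elim: t => // t; apply: mem_percS. Qed.

Lemma percolates_byP S t : reflect (forall x, x \in perc S t) (percolates_by S t).
Proof.
apply: (iffP eqP) => [eqT x | all_in]; first by rewrite /perc eqT inE.
by apply/setP=> x; rewrite inE; apply: all_in.
Qed.

Lemma perc_time_of_percolates S : hull_set S -> percolates_by S (perc_time_of S).
Proof.
by rewrite /perc_time_of; case: pselect => // h _; case: ex_minnP.
Qed.

Lemma perc_time_of_leq S t : percolates_by S t -> perc_time_of S <= t.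
Proof.
rewrite /perc_time_of; case: pselect => // h St.
by case: ex_minnP => m _; apply.
Qed.

(** If the first step infected no vertex, the process would stay at [S]. *)
Lemma hull_set_seed S : hull_set S -> S != [set: G] ->
  exists v a b, [/\ a \in S, b \in S, a != b, v -- a & v -- b].
Proof.
case=> k hk SV.
have [/existsP[v /andP[vS /perc_stepP[vS'|[a [b H]]]]]|no_new] :=
  boolP [exists v, (v \notin S) && (v \in perc_step S)].
- by rewrite vS' in vS.
- by exists v, a, b.
have fixS : perc_step S = S.
  apply/eqP; rewrite eqEsubset perc_sub_step andbT; apply/subsetP=> x xS.
  by apply: contraNT no_new => xnS; apply/existsP; exists x; rewrite xnS.
have iterS : iter k (@perc_step G) S = S by elim: k {hk} => //= k ->.
by move: hk SV; rewrite /percolates_by iterS => ->.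
Qed.

Lemma perc_time_max S : hull_set S ->
  (forall S', hull_set S' -> perc_time_of S' <= perc_time_of S) ->
  perc_time G = perc_time_of S.
Proof.
move=> hS maxS; apply/eqP; rewrite eqn_leq; apply/andP; split.
  by apply/bigmax_leqP=> S' /asboolP; apply: maxS.
by rewrite /perc_time; apply: (@leq_bigmax_cond _ _ (@perc_time_of G)); apply/asboolP.
Qed.

End Percolation.

(** * Umbrella numberings *)

(** This is the form in which a unit interval order is used; stated through a
    function instead of a sequence, it is stable under reversal and easy to
    give for the concrete graph built below. *)
Definition umbrella_numbering (G : sgraph) (pos : G -> nat) : Prop :=
  [/\ injective pos, forall x, pos x < #|G|
    & forall x y z, pos x < pos y < pos z -> x -- z -> x -- y /\ y -- z].

Section Numbering.
Variables (G : sgraph) (pos : G -> nat).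
Hypothesis num : umbrella_numbering pos.
Implicit Types (x y z u v a b c : G) (S A C : {set G}).

Lemma pos_inj : injective pos. Proof. by case: num. Qed.

Lemma pos_lt x : pos x < #|G|. Proof. by case: num. Qed.

Lemma pos_neq x y : pos x != pos y -> x != y.
Proof. by apply: contraNneq => ->. Qed.

Lemma pos_onto i : i < #|G| -> exists x, pos x = i.
Proof.
move=> iG; pose f x := Ordinal (pos_lt x).
have injf : injective f by move=> x y [] /pos_inj.
have /codomP[x fx] : Ordinal iG \in codom f.
  by apply: inj_card_onto => //; rewrite card_ord.
by exists x; move/(congr1 val): fx.
Qed.

Lemma umbrella_right x c z : pos x <= pos c -> pos c < pos z -> x -- z -> c -- z.
Proof.
case: num => _ _ umb; rewrite leq_eqVlt => /orP[/eqP/pos_inj -> // | xc cz xz].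
by have [|_] := umb x c z _ xz; rewrite ?xc.
Qed.

Lemma umbrella_left x c z : pos x < pos c -> pos c <= pos z -> x -- z -> x -- c.
Proof.
case: num => _ _ umb xc; rewrite leq_eqVlt => /orP[/eqP/pos_inj -> // | cz xz].
by have [|+ _] := umb x c z _ xz; rewrite ?xc.
Qed.

Definition rev_pos x := #|G|.-1 - pos x.

Lemma rev_numbering : umbrella_numbering rev_pos.
Proof.
split=> [x y | x | x y z].
- by have := pos_lt x; have := pos_lt y; rewrite /rev_pos => ? ? ?; apply: pos_inj; lia.
- by have := pos_lt x; rewrite /rev_pos; lia.
have := pos_lt x; have := pos_lt y; have := pos_lt z; rewrite /rev_pos => ? ? ? lt zx.
rewrite edge_sym in zx.
by split; rewrite edge_sym; [apply: umbrella_right zx | apply: umbrella_left zx]; lia.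
Qed.

(** Infection from [A] passes from the left of [x] to some [z] at its right
    only along an edge, which makes [z] adjacent to both [x] and [y]. *)
Lemma perc_right_mono A C x y :
  pos y = (pos x).+1 -> x \in C -> y \in C ->
  (forall z, z \in A -> pos x <= pos z -> z \in C) ->
  forall t z, z \in perc A t -> pos x <= pos z -> z \in perc C t.
Proof.
move=> yx xC yC subAC; elim=> [|t IH] z; first exact: subAC.
rewrite percS => /perc_stepP[zA xz | [u [v [uA vA uv zu zv]]] xz].
  exact/mem_percS/IH.
have [zx | nzx] := eqVneq z x; first by rewrite zx mem_perc.
have [zy | nzy] := eqVneq z y; first by rewrite zy mem_perc.
have yz : pos y < pos z.
  have : pos z != pos x by apply: contra nzx => /eqP/pos_inj->.
  have : pos z != pos y by apply: contra nzy => /eqP/pos_inj->.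
  lia.
have near w : z -- w -> pos w < pos x -> z \in perc C t.+1.
  rewrite edge_sym => wz wx; rewrite percS.
  apply: (@perc_step_pair _ _ _ x y); rewrite ?mem_perc //.
  - by apply: pos_neq; lia.
  - by rewrite edge_sym; apply: umbrella_right wz; lia.
  - by rewrite edge_sym; apply: umbrella_right wz; lia.
have [/(near _ zu) // | xu] := ltnP (pos u) (pos x).
have [/(near _ zv) // | xv] := ltnP (pos v) (pos x).
by rewrite percS; apply: (@perc_step_pair _ _ _ u v) => //; apply: IH.
Qed.

(** If the two vertices that infect [u] lie beyond [v], then [v] is adjacent to
    them as well; if one of them does not, induction applies to it. *)
Lemma perc_pair_left_convex x y t u v :
  pos y = (pos x).+1 -> u \in perc [set x; y] t ->
  pos u <= pos v <= pos x -> v \in perc [set x; y] t.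
Proof.
move=> yx; elim: t u v => [|t IH] u v.
  rewrite !inE => /orP[] /eqP -> uvx; last lia.
  by apply/orP; left; apply/eqP/pos_inj; lia.
rewrite percS => /perc_stepP[uP | [a [b [aP bP ab ua ub]]]] uvx.
  exact/mem_percS/(IH u).
have [av | va] := leqP (pos a) (pos v); first by apply/mem_percS/(IH a) => //; lia.
have [bv | vb] := leqP (pos b) (pos v); first by apply/mem_percS/(IH b) => //; lia.
apply: (@perc_step_pair _ _ _ a b) => //.
  by apply: umbrella_right ua; lia.
by apply: umbrella_right ub; lia.
Qed.

(** * The end pair is slower than any other seed *)

Section Seeds.
Variables (e0 e1 : G).
Hypotheses (pos_e0 : pos e0 = 0) (pos_e1 : pos e1 = 1).

Lemma perc_end_step z :
  z \in perc [set e0; e1] 1 -> pos z <= 1 \/ e0 -- z.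
Proof.
rewrite percS => /perc_stepP[]; first by rewrite !inE => /orP[] /eqP ->; left; lia.
case=> u [v []]; rewrite !inE => uE vE uv; rewrite !(edge_sym z) => uz vz; right.
by case/orP: uE uv => /eqP uE; case/orP: vE => /eqP vE; subst; rewrite ?eqxx.
Qed.

(** After one step the interval from [a] to [b] is infected, and so are the
    common neighbours of [a] and [b], among which are all the neighbours of [e0]
    beyond [b]. *)
Lemma adjacent_seed S a b t z :
  a \in S -> b \in S -> pos a < pos b -> a -- b ->
  z \in perc [set e0; e1] t.+1 -> pos a <= pos z -> z \in perc S t.+1.
Proof.
move=> aS bS ab aEb; have bG := pos_lt b.
have between w : pos a <= pos w <= pos b -> w \in perc S 1.
  have [-> | nwa] := eqVneq w a; first by rewrite mem_perc.
  have [-> | nwb] := eqVneq w b; first by rewrite mem_perc.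
  have : pos w != pos a by apply: contra nwa => /eqP/pos_inj->.
  have : pos w != pos b by apply: contra nwb => /eqP/pos_inj->.
  move=> ? ? ?; rewrite percS; apply: (@perc_step_pair _ _ _ a b) => //.
  - by apply: pos_neq; lia.
  - by rewrite edge_sym; apply: umbrella_left aEb; lia.
  - by apply: umbrella_right aEb; lia.
have [c pos_c] : exists c, pos c = (pos a).+1 by apply: pos_onto; lia.
rewrite !percSr; apply: (@perc_right_mono _ _ a c) => //.
- by apply: between; lia.
- by apply: between; lia.
move=> w wE aw.
have [wb | bw] := leqP (pos w) (pos b); first by apply: between; lia.
have [| e0w] := perc_end_step wE; first lia.
apply: (@perc_step_pair _ _ _ a b) => //.
- by apply: pos_neq; lia.
- by rewrite edge_sym; apply: umbrella_right e0w; lia.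
- by rewrite edge_sym; apply: umbrella_right e0w; lia.
Qed.

(** A vertex of the first step from [e0], [e1] that lies at the right of [v] is
    adjacent to [a], hence lies before [b], as [a] and [b] are not adjacent; so
    it is a common neighbour of [a] and [b].  [v] may be the only one: two
    consecutive vertices are then infected from [S] only at time 2, from which
    [perc_right_mono] can start. *)
Lemma nonadjacent_seed S a b v t z :
  a \in S -> b \in S -> pos a < pos v < pos b -> v -- a -> v -- b -> ~~ a -- b ->
  z \in perc [set e0; e1] t.+1 -> pos v <= pos z -> z \in perc S t.+1.
Proof.
move=> aS bS avb va vb nab; have bG := pos_lt b.
have first w : w \in perc [set e0; e1] 1 -> pos v <= pos w -> w \in perc S 1.
  move=> wE vw.
  have aw : a -- w.
    have [|e0w] := perc_end_step wE; last by apply: umbrella_right e0w; lia.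
    by move=> w1; have /pos_inj <- : pos v = pos w; [lia | rewrite edge_sym].
  have wb : pos w < pos b.
    rewrite ltnNge; apply: contra nab => bw; apply: umbrella_left aw; lia.
  rewrite percS; apply: (@perc_step_pair _ _ _ a b) => //.
  - by apply: pos_neq; lia.
  - by rewrite edge_sym.
  - by apply: umbrella_right vb; lia.
have vS : v \in perc S 1.
  by rewrite percS; apply: (@perc_step_pair _ _ _ a b) => //; apply: pos_neq; lia.
have right_nbr w : v -- w -> pos v < pos w -> w \in perc S 2.
  move=> vw ltvw; have [-> | nwb] := eqVneq w b; first by rewrite mem_perc.
  have pwb : pos w != pos b by apply: contra nwb => /eqP/pos_inj->.
  rewrite percS; apply: (@perc_step_pair _ _ _ v b) => //; rewrite ?mem_perc //.
  - by apply: pos_neq; lia.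
  - by rewrite edge_sym.
  - case: (ltngtP (pos w) (pos b)) pwb => // [wb | bw] _.
      by apply: umbrella_right vb; lia.
    by rewrite edge_sym; apply: umbrella_right vw; lia.
have [c pos_c] : exists c, pos c = (pos v).+1 by apply: pos_onto; lia.
case: t => [|t]; first exact: first.
rewrite !percSr -/(perc _ _); apply: (@perc_right_mono _ _ v c) => //.
- exact: (mem_percS vS).
- apply: (right_nbr c); last lia.
  by apply: umbrella_left vb; lia.
move=> w; rewrite -[perc_step _]/(perc [set e0; e1] 2) -[perc_step (perc_step S)]/(perc S 2).
rewrite percS => /perc_stepP[wE vw | [x [y [xE yE xy wx wy]]] vw].
  exact/mem_percS/first.
have [/pos_inj <- | nvw] := eqVneq (pos v) (pos w); first exact: mem_percS.
have near u : w -- u -> pos u < pos v -> w \in perc S 2.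
  move=> wu uv; apply: right_nbr; last lia.
  by apply: (@umbrella_right u); rewrite 1?edge_sym //; lia.
have [/(near _ wx) // | vx] := ltnP (pos x) (pos v).
have [/(near _ wy) // | vy] := ltnP (pos y) (pos v).
by rewrite percS; apply: (@perc_step_pair _ _ _ x y) => //; apply: first.
Qed.

End Seeds.

(** * Equal speed in both directions *)

Hypothesis G2 : two_connected G.

Lemma card_gt2 : 2 < #|G|. Proof. by case/and3P: G2. Qed.

(** A path that joins [x] to [z] and avoids the vertex between them has an edge
    that jumps over that vertex; this edge spans [x] and [z]. *)
Lemma two_connected_skip x z : pos z = (pos x).+2 -> x -- z.
Proof.
move=> zx; have [y pos_y] : exists y, pos y = (pos x).+1.
  by apply: pos_onto; have := pos_lt z; lia.
case/and3P: G2 => _ _ /forallP/(_ y)/forall_inP/(_ x) cx.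
have xy : x \in [set~ y] by rewrite !inE; apply: pos_neq; lia.
have zy : z \in [set~ y] by rewrite !inE; apply: pos_neq; lia.
have {cx xy zy} /connectP[p] := forall_inP (cx xy) z zy.
suff cross u : pos u <= pos x ->
    path [rel a b | [&& a \in [set~ y], b \in [set~ y] & a -- b]] u p ->
    z = last u p -> x -- z.
  exact: cross.
elim: p u => [|w p IH] u ux /=; first by move=> _ zu; rewrite zu in zx; lia.
case/andP=> /and3P[_ wy uw] pth zl; rewrite !inE in wy.
have [wx | xw] := leqP (pos w) (pos x); first exact: (IH w).
have pwy : pos w != pos y by apply: contra wy => /eqP/pos_inj->.
have uz : u -- z by apply: umbrella_left uw; lia.
by apply: umbrella_right uz; lia.
Qed.

(** There are at least three vertices, so one of the edges given by
    [two_connected_skip] spans [x] and [y]. *)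
Lemma two_connected_succ x y : pos y = (pos x).+1 -> x -- y.
Proof.
move=> yx; have := pos_lt y; have := card_gt2 => ? ?.
have [lt | ge] := ltnP (pos y).+1 #|G|.
  have [z pos_z] := pos_onto lt; have xz : x -- z by apply: two_connected_skip; lia.
  by apply: umbrella_left xz; lia.
have [|w pos_w] := @pos_onto (pos x).-1; first by lia.
have wy : w -- y by apply: two_connected_skip; lia.
by apply: umbrella_right wy; lia.
Qed.

Lemma perc_end_hull e0 e1 : pos e0 = 0 -> pos e1 = 1 -> hull_set [set e0; e1].
Proof.
move=> pe0 pe1; exists #|G|; apply/percolates_byP=> x.
suff grow t z : pos z <= t.+1 -> z \in perc [set e0; e1] t.
  by apply: grow; have := pos_lt x; lia.
elim: t z => [|t IH] z zt.
  rewrite !inE; have [z0|z1] : pos z = 0 \/ pos z = 1 by lia.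
    by apply/orP; left; apply/eqP/pos_inj; lia.
  by apply/orP; right; apply/eqP/pos_inj; lia.
have [zt'|tz] := leqP (pos z) t.+1; first exact/mem_percS/IH.
have [u pu] : exists u, pos u = t by apply: pos_onto; have := pos_lt z; lia.
have [v pv] : exists v, pos v = t.+1 by apply: pos_onto; have := pos_lt z; lia.
rewrite percS; apply: (@perc_step_pair _ _ _ u v); try by apply: IH; lia.
- by apply: pos_neq; lia.
- by rewrite edge_sym; apply: two_connected_skip; lia.
- by rewrite edge_sym; apply: two_connected_succ; lia.
Qed.

(** Induction peels the first step off the process from [x], [x'] and the last
    step off the process from [y], [y'].  With [m] the last neighbour of [x], the
    first step replaces the right end [x'] by [m]; and [x] is infected in the
    last step as soon as [m] and its predecessor are. *)
Lemma perc_duality t x x' y y' :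
  pos x' = (pos x).+1 -> pos y' = (pos y).+1 -> pos x <= pos y ->
  y' \in perc [set x; x'] t -> x \in perc [set y; y'] t.
Proof.
move=> px' py'; elim: t x x' px' => [|t IH] x x' px' xy.
  rewrite !inE => /orP[] /eqP eqy; first by rewrite eqy in py'; lia.
  by apply/orP; left; apply/eqP/pos_inj; rewrite eqy in py'; lia.
move=> y'x; have y'G := pos_lt y'.
have [xEy' | nxy'] := boolP (x -- y').
  have [/pos_inj -> | nxy] := eqVneq (pos x) (pos y); first by rewrite mem_perc // !inE eqxx.
  rewrite percS; apply: (@perc_step_pair _ _ _ y y') => //; rewrite ?mem_perc ?inE ?eqxx ?orbT //.
    by apply: pos_neq; lia.
  by apply: umbrella_left xEy'; lia.
have xx' : x -- x' by apply: two_connected_succ.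
have [m xm maxm] := @arg_maxnP _ x' (fun z => x -- z) pos xx'.
(* x has a neighbour two places away, since y' is not adjacent to x *)
have mx2 : (pos x).+1 < pos m.
  have [|w pw] := @pos_onto (pos x).+2.
    have : pos y' != (pos x).+1.
      by apply: contra nxy' => /eqP ?; apply: two_connected_succ.
    lia.
  have := maxm w; rewrite pw; apply; exact: two_connected_skip.
have my : pos m < pos y'.
  rewrite ltnNge; apply: contra nxy' => ?; apply: umbrella_left xm; lia.
have [m' pm'] : exists m', pos m' = (pos m).-1 by apply: pos_onto; lia.
have y'm : y' \in perc [set m'; m] t.
  move: y'x; rewrite percSr => /(@perc_right_mono _ [set m'; m] m' m); apply; try lia.
  - by rewrite !inE eqxx.
  - by rewrite !inE eqxx orbT.
  move=> z /perc_stepP zx m'z.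
  have zm : pos z <= pos m.
    case: zx => [|[u [v [+ + uv zu zv]]]].
      by rewrite !inE => /orP[] /eqP ->; lia.
    rewrite !inE => /orP uE /orP vE; apply: maxm; rewrite edge_sym.
    by case: uE vE uv => /eqP uE [] /eqP vE; subst; rewrite ?eqxx.
  rewrite !inE; have [ez|ez] : pos z = pos m \/ pos z = pos m' by lia.
    by apply/orP; right; apply/eqP/pos_inj.
  by apply/orP; left; apply/eqP/pos_inj.
have m'y : m' \in perc [set y; y'] t by apply: IH y'm; lia.
rewrite percS; apply: (@perc_step_pair _ _ _ m' m) => //.
- by apply: (perc_pair_left_convex py' m'y); lia.
- by apply: pos_neq; lia.
- by apply: umbrella_left xm; lia.
Qed.

Lemma percolates_opposite e0 e1 f0 f1 t :
  pos e0 = 0 -> pos e1 = 1 -> pos f0 = #|G|.-1 -> pos f1 = #|G|.-2 ->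
  percolates_by [set e0; e1] t -> percolates_by [set f0; f1] t.
Proof.
move=> pe0 pe1 pf0 pf1 /percolates_byP Et; apply/percolates_byP=> x.
have := card_gt2 => ?; have xG := pos_lt x.
have [xf0 | nxf0] := eqVneq (pos x) (pos f0).
  by rewrite (pos_inj xf0) mem_perc // !inE eqxx.
have e0f : e0 \in perc [set f1; f0] t by apply: (@perc_duality _ _ e1) => //; lia.
by rewrite setUC; apply: (perc_pair_left_convex _ e0f); lia.
Qed.

End Numbering.

(** By symmetry this also covers the last two vertices, for the reversed
    numbering. *)
Theorem perc_time_end (G : sgraph) (pos : G -> nat) (e0 e1 : G) :
  umbrella_numbering pos -> two_connected G -> pos e0 = 0 -> pos e1 = 1 ->
  hull_set [set e0; e1] /\ perc_time G = perc_time_of [set e0; e1].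
Proof.
move=> num G2 pe0 pe1.
have hE := perc_end_hull num G2 pe0 pe1; split=> //.
apply: perc_time_max => // S hS; apply: perc_time_of_leq.
have ET := perc_time_of_percolates hE; set T := perc_time_of _ in ET *.
have n3 := card_gt2 G2.
have [f0 pf0] : exists x, pos x = #|G|.-1 by apply: (pos_onto num); lia.
have [f1 pf1] : exists x, pos x = #|G|.-2 by apply: (pos_onto num); lia.
have FT : percolates_by [set f0; f1] T.
  exact: (percolates_opposite num G2 pe0 pe1).
have rnum := rev_numbering num.
have rf0 : rev_pos pos f0 = 0 by rewrite /rev_pos; lia.
have rf1 : rev_pos pos f1 = 1 by rewrite /rev_pos; lia.
have [-> | SV] := eqVneq S [set: G].
  by apply/percolates_byP=> x; rewrite mem_perc ?inE.
have [v [a [b [aS bS ab va vb]]]] := hull_set_seed hS SV.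
wlog lt_ab : a b aS bS ab va vb / pos a < pos b.
  move=> hw; case: (ltngtP (pos a) (pos b)) => [lt|lt|/(pos_inj num) eab].
  - exact: (hw a b).
  - by apply: (hw b a) => //; rewrite eq_sym.
  - by rewrite eab eqxx in ab.
have [aG bG vG] := And3 (pos_lt num a) (pos_lt num b) (pos_lt num v).
(* time 0 is impossible: the seed lemmas speak of at least one step *)
case: T ET FT => [|t] /percolates_byP ET /percolates_byP FT.
  have [g pg] : exists x, pos x = 2 by apply: (pos_onto num); lia.
  by have := ET g; rewrite !inE => /orP[] /eqP eg; rewrite eg in pg; lia.
apply/percolates_byP=> x; have xG := pos_lt num x.
have [aEb | naEb] := boolP (a -- b).
  have [ax | xa] := leqP (pos a) (pos x).
    exact: (adjacent_seed num pe0 pe1 aS bS lt_ab aEb).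
  by apply: (adjacent_seed rnum rf0 rf1 bS aS) => //; rewrite 1?edge_sym // /rev_pos; lia.
have avb : pos a < pos v < pos b.
  have nva : pos v != pos a.
    by apply/eqP=> /(pos_inj num) eva; rewrite eva edge_irrefl in va.
  have nvb : pos v != pos b.
    by apply/eqP=> /(pos_inj num) evb; rewrite evb edge_irrefl in vb.
  apply/andP; split; rewrite ltnNge; apply: contra naEb => ?.
    by apply: (umbrella_right num) vb; lia.
  by apply: (@umbrella_left _ _ num a b v); rewrite 1?edge_sym //; lia.
have [vx | xv] := leqP (pos v) (pos x).
  exact: (nonadjacent_seed num pe0 pe1 aS bS avb).
apply: (nonadjacent_seed rnum rf0 rf1 bS aS _ vb va) => //; rewrite 1?edge_sym // /rev_pos; lia.
Qed.

(** * Unit interval orders are umbrella numberings *)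

Section OrderIndex.
Variables (G : sgraph) (s : seq G).
Hypothesis ord_s : unit_interval_order s.

Lemma size_order : size s = #|G|.
Proof.
by case: ord_s => /card_uniqP <- memG _; apply: eq_card => x; rewrite memG.
Qed.

Lemma order_index_numbering : umbrella_numbering (fun x => index x s).
Proof.
case: (ord_s) => us memG nbh_infix.
have ins x : x \in s by rewrite memG.
have convex x y z w : y \in cl_nbh x -> z \in cl_nbh x ->
    index y s <= index w s <= index z s -> w \in cl_nbh x.
  move=> yx zx; case/infixP: (nbh_infix x) => s1 [s2]; set F := filter _ _ => sE.
  have yF : y \in F by rewrite mem_filter yx ins.
  have zF : z \in F by rewrite mem_filter zx ins.
  have [wF _ | nwF] := boolP (w \in F); first by move: wF; rewrite mem_filter => /andP[].
  have [n1F nF2] : ~~ has [in s1] F /\ ~~ has [in F] s2.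
    move: us; rewrite sE !cat_uniq has_cat negb_or.
    by case/and3P=> _ /andP[] ? _ /and3P[].
  have ns1 v : v \in F -> v \notin s1 by move=> vF; apply: contra n1F => ?; apply/hasP; exists v.
  have yi : size s1 <= index y s by rewrite sE index_cat (negbTE (ns1 _ yF)) leq_addr.
  have zi : index z s < size s1 + size F.
    by rewrite sE index_cat (negbTE (ns1 _ zF)) ltn_add2l index_cat zF index_mem.
  have [ws1 | nws1] := boolP (w \in s1).
    have : index w s < size s1 by rewrite sE index_cat ws1 index_mem.
    lia.
  have : size s1 + size F <= index w s.
    by rewrite sE index_cat (negbTE nws1) leq_add2l index_cat (negbTE nwF) leq_addr.
  lia.
split=> [x y eqxy | x | x y z xyz xz].
- by rewrite -(nth_index x (ins x)) eqxy nth_index.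
- by rewrite -size_order index_mem.
have nxy : y != x by apply/eqP=> eyx; rewrite eyx in xyz; lia.
have nyz : y != z by apply/eqP=> eyz; rewrite eyz in xyz; lia.
have : y \in cl_nbh x by apply: (convex x x z); rewrite ?inE ?eqxx ?xz ?orbT //; lia.
have : y \in cl_nbh z.
  by apply: (convex z x z); rewrite ?inE ?eqxx 1?edge_sym ?xz ?orbT //; lia.
by rewrite !inE (negbTE nxy) (negbTE nyz) /= edge_sym.
Qed.

End OrderIndex.

(** * The doubled path *)

Lemma walk_cons (G : sgraph) (u w v : G) l :
  u -- w -> walk_of_length w v l -> walk_of_length u v l.+1.
Proof.
move=> uw /existsP[p pth]; apply/existsP; exists (cons_tuple w p).
by rewrite /= uw.
Qed.

Section DoubledPath.
Variable k : nat.

Definition dpath_vertex : finType := ('I_k.+1 * bool)%type.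
(** The path with [k] edges in which each vertex is replaced by two adjacent
    twins. *)
Definition dpath_edge (u v : dpath_vertex) :=
  [&& u != v, u.1 <= v.1.+1 & v.1 <= u.1.+1].

Lemma dpath_sym : symmetric dpath_edge.
Proof. by move=> u v; rewrite /dpath_edge eq_sym; congr (_ && _); apply: andbC. Qed.

Lemma dpath_irrefl : irreflexive dpath_edge.
Proof. by move=> u; rewrite /dpath_edge eqxx. Qed.

Definition dpath := SGraph dpath_sym dpath_irrefl.
Implicit Types (u v w x : dpath).

Definition level u : nat := (u : 'I_k.+1 * bool).1.
Definition side u : bool := (u : 'I_k.+1 * bool).2.
Definition vtx i b : dpath := (inord i, b).

Lemma dpathE u v : u -- v = [&& u != v, level u <= (level v).+1 & level v <= (level u).+1].
Proof. by []. Qed.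

Lemma level_lt u : level u < k.+1. Proof. exact: ltn_ord. Qed.

Lemma level_vtx i b : i <= k -> level (vtx i b) = i.
Proof. by move=> ik; rewrite /level /= inordK. Qed.

Lemma side_vtx i b : side (vtx i b) = b. Proof. by []. Qed.

Lemma dpath_eqE u v : (u == v) = (level u == level v) && (side u == side v).
Proof. by []. Qed.

Lemma card_dpath : #|dpath| = k.+1.*2.
Proof. by rewrite card_prod card_ord card_bool muln2. Qed.

Lemma dpath_numbering : umbrella_numbering (fun u : dpath => (level u).*2 + side u).
Proof.
split=> [u v e | u | x y z].
- apply/eqP; rewrite dpath_eqE; apply/andP.
  by case: (side u) (side v) e => -[] /=; lia.
- by rewrite card_dpath; have := level_lt u; case: (side u); lia.
rewrite !dpathE !dpath_eqE.
case: (side x) (side y) (side z) => -[] [] /=; rewrite ?andbT ?andbF /=; lia.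
Qed.

(** The vertices on one side form a path, and each other vertex is adjacent to
    its twin on that path.  Removing a vertex leaves the other side intact. *)
Lemma dpath_column_connected (b : bool) (D : {set dpath}) :
  (forall i, i <= k -> vtx i b \in D) -> connected_on D.
Proof.
move=> colD; set e := [rel a c | [&& a \in D, c \in D & (a : dpath) -- c]].
have sym_e : connect_sym e.
  by apply: sym_connect_sym => a c /=; rewrite dpath_sym andbCA.
have base i : i <= k -> connect e (vtx i b) (vtx 0 b).
  elim: i => [|i IH] ik; first exact: connect0.
  apply: connect_trans (IH (ltnW ik)); apply: connect1.
  apply/and3P; split; [exact: colD | exact/colD/ltnW |].
  by rewrite dpathE dpath_eqE !level_vtx //; lia.
have toe u : u \in D -> connect e u (vtx 0 b).
  move=> uD; have uk := level_lt u.
  apply: connect_trans (base (level u) _); last by lia.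
  have [<- | nu] := eqVneq u (vtx (level u) b); first exact: connect0.
  apply: connect1; apply/and3P; split=> //; first by apply: colD; lia.
  by rewrite dpathE nu level_vtx; lia.
apply/forall_inP=> u uD; apply/forall_inP=> v vD.
by apply: connect_trans (toe u uD) _; rewrite sym_e; apply: toe.
Qed.

Lemma dpath_two_connected : 0 < k -> two_connected dpath.
Proof.
move=> k0; apply/and3P; split; first by rewrite card_dpath; lia.
  by apply: (@dpath_column_connected true) => i _; rewrite inE.
apply/forallP=> x; apply: (@dpath_column_connected (~~ side x)) => i ik.
by rewrite !inE dpath_eqE side_vtx; case: (side x); rewrite andbF.
Qed.

Definition twin u : dpath := ((u : 'I_k.+1 * bool).1, ~~ side u).

Lemma twin_neq u : twin u != u.
Proof. by rewrite dpath_eqE /twin /side /=; case: (_.2); rewrite andbF. Qed.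

(** Adjacent twins have the same closed neighbourhood, so any clique extends by
    the twin of its members. *)
Lemma maxclique_twin A u : maxset (@clique dpath) A -> u \in A -> twin u \in A.
Proof.
case/maxsetP=> cliA maxA uA.
have adj v w : v \in A -> w \in A -> v != w -> v -- w.
  by move=> vA wA; apply/implyP; apply: (forall_inP (forall_inP cliA v vA)).
have tw w : w \in A -> twin u != w -> twin u -- w.
  move=> wA nw; rewrite dpathE nw /=.
  have [<- | nuw] := eqVneq u w; first by rewrite /level /=; lia.
  by have := adj u w uA wA nuw; rewrite dpathE => /and3P[_ uw wu]; apply/andP.
rewrite -(maxA (twin u |: A)) ?inE ?eqxx ?subsetUr //.
apply/forall_inP=> v; rewrite !inE => vA; apply/forall_inP=> w; rewrite !inE => wA.
apply/implyP; case/orP: vA => [/eqP -> | vA]; case/orP: wA => [/eqP -> | wA].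
- by rewrite eqxx.
- exact: tw.
- by rewrite eq_sym edge_sym; apply: tw.
- exact: adj.
Qed.

(** Twins are at distance one although their levels agree, whence [0 < m]. *)
Lemma dpath_walk m u v : 0 < m -> level u <= level v + m -> level v <= level u + m ->
  exists2 l, l <= m & walk_of_length u v l.
Proof.
case: m => // m _; elim: m u => [|m IH] u uv vu.
  have [-> | nuv] := eqVneq u v.
    by exists 0 => //; apply/existsP; exists [tuple]; rewrite /= eqxx.
  exists 1 => //; apply: (@walk_cons _ u v); first by rewrite dpathE nuv; lia.
  by apply/existsP; exists [tuple]; rewrite /= eqxx.
have uk := level_lt u; have vk := level_lt v.
pose w := vtx (if level u <= level v then (level u).+1 else (level u).-1) (side v).
have [near | far] := boolP ((level u <= level v + m.+1) && (level v <= level u + m.+1)).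
  by case/andP: near => uv' vu'; have [l lm ul] := IH u uv' vu'; exists l; first lia.
have lw : level w = if level u <= level v then (level u).+1 else (level u).-1.
  by rewrite level_vtx //; case: (leqP (level u) (level v)); lia.
have [||l lm wl] := IH w; [by rewrite lw; case: (leqP (level u) (level v)); lia..|].
exists l.+1 => //; apply: walk_cons wl.
by rewrite dpathE dpath_eqE lw; case: (leqP (level u) (level v)); lia.
Qed.

Lemma dpath_walk_level m u v : walk_of_length u v m -> level v <= level u + m.
Proof.
case/existsP=> -[p /= /eqP <-] /andP[].
elim: p u => [|w q IH] u /=; first by move=> _ /eqP <-; lia.
case/andP=> /and3P[_ _ wu] wq /(IH w wq).
have : level w <= (level u).+1 := wu; lia.
Qed.

Lemma dpath_diam : 0 < k -> diam dpath = k.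
Proof.
move=> k0; apply/eqP; rewrite eqn_leq; apply/andP; split.
  apply/bigmax_leqP=> u _; apply/bigmax_leqP=> v _.
  have := level_lt u; have := level_lt v => ? ?.
  have [||l lk ul] := @dpath_walk k u v k0; [lia..|].
  rewrite /dist; case: pselect => // h; case: ex_minnP => m _ /(_ l ul); lia.
pose u := vtx 0 false; pose v := vtx k false.
apply: leq_trans (leq_trans (leq_bigmax v) (leq_bigmax u)).
have [||l lk ul] := @dpath_walk k u v k0; rewrite ?level_vtx //; [lia..|].
rewrite /dist; case: pselect => [h|[]]; last by exists l.
by case: ex_minnP => m /dpath_walk_level; rewrite !level_vtx.
Qed.

Lemma dpath_perc t u : (u \in perc [set vtx 0 false; vtx 0 true] t) = (level u <= t).
Proof.
elim: t u => [|t IH] u.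
  by rewrite !inE !dpath_eqE !level_vtx // !side_vtx; case: (side u); rewrite ?andbT ?andbF ?orbF leqn0.
have uk := level_lt u.
apply/idP/idP; rewrite percS.
  case/perc_stepP=> [|[v [w []]]]; rewrite !IH; first lia.
  by move=> vt _ _; rewrite dpathE => /and3P[]; lia.
move=> ut; have [ut' | tu] := leqP (level u) t.
  by rewrite (subsetP (perc_sub_step _)) // IH.
have lt b : level (vtx t b) = t by rewrite level_vtx //; lia.
apply: (@perc_step_pair _ _ _ (vtx t false) (vtx t true)); rewrite ?IH ?lt //.
- by rewrite dpath_eqE !side_vtx andbF.
- by rewrite dpathE dpath_eqE lt; lia.
- by rewrite dpathE dpath_eqE lt; lia.
Qed.

Lemma dpath_perc_time : 0 < k -> perc_time dpath = k.
Proof.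
move=> k0.
have [h ->] : hull_set [set vtx 0 false; vtx 0 true] /\
    perc_time dpath = perc_time_of [set vtx 0 false; vtx 0 true].
  by apply: (perc_time_end dpath_numbering (dpath_two_connected k0)); rewrite level_vtx.
apply/eqP; rewrite eqn_leq; apply/andP; split.
  by apply/perc_time_of_leq/percolates_byP=> u; rewrite dpath_perc -ltnS level_lt.
have /percolates_byP/(_ (vtx k false)) := perc_time_of_percolates h.
by rewrite dpath_perc level_vtx.
Qed.

(** Twins share an interval; two intervals meet in the larger of their left ends
    if they meet at all. *)
Lemma dpath_unit_interval (R : realType) : unit_interval_graph dpath R.
Proof.
exists (fun u => (level u)%:R)%R => u v; rewrite dpathE; split.
  case/and3P=> /eqP uv luv lvu; split=> //.
  exists (maxn (level u) (level v))%:R%R.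
  by rewrite !in_itv /= !natr1 !ler_nat; lia.
case=> /eqP -> [t []]; rewrite !in_itv /= => /andP[ut tu] /andP[vt tv].
have := le_trans ut tv; have := le_trans vt tu.
by rewrite !natr1 !ler_nat => -> ->.
Qed.

End DoubledPath.

(** * The percolation time of a unit interval graph *)

Theorem theorem5 (R : realType) (G : sgraph) (s : seq G) (x0 : G) :
  unit_interval_graph G R -> two_connected G -> 3 <= #|G| ->
  unit_interval_order s ->
  (exists H : sgraph,
     [/\ two_connected H,
         unit_interval_graph H R,
         (forall A B : {set H}, maxset (@clique H) A -> maxset (@clique H) B ->
            A != B -> A :&: B != set0 -> 2 <= #|A :&: B|),
         perc_time G = perc_time H
       & perc_time H = diam H]) /\
  [/\ hull_set [set nth x0 s 0; nth x0 s 1],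
      perc_time G = perc_time_of [set nth x0 s 0; nth x0 s 1],
      hull_set [set nth x0 s (size s).-2; nth x0 s (size s).-1]
    & perc_time G =
        perc_time_of [set nth x0 s (size s).-2; nth x0 s (size s).-1]].
Proof.
move=> _ G2 n3 ord_s; have num := order_index_numbering ord_s.
have sz := size_order ord_s; have [us _ _] := ord_s.
have [hE tauE] : hull_set [set nth x0 s 0; nth x0 s 1] /\
    perc_time G = perc_time_of [set nth x0 s 0; nth x0 s 1].
  by apply: (perc_time_end num G2); rewrite index_uniq // ?sz; lia.
have [hF tauF] : hull_set [set nth x0 s (size s).-1; nth x0 s (size s).-2] /\
    perc_time G = perc_time_of [set nth x0 s (size s).-1; nth x0 s (size s).-2].
  by apply: (perc_time_end (rev_numbering num) G2); rewrite /rev_pos index_uniq // ?sz; lia.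
split; last by split; rewrite // setUC.
have tau0 : 0 < perc_time G.
  rewrite tauE lt0n; apply/eqP=> tau0.
  have /percolates_byP/(_ (nth x0 s 2)) := perc_time_of_percolates hE.
  by rewrite tau0 !inE !nth_uniq // ?sz; lia.
exists (dpath (perc_time G)); split.
- exact: dpath_two_connected.
- exact: dpath_unit_interval.
- move=> A B maxA maxB _ /set0Pn[u /setIP[uA uB]]; apply/card_gt1P.
  by exists (twin u), u; rewrite !inE uA uB !maxclique_twin ?twin_neq.
- by rewrite dpath_perc_time.
- by rewrite dpath_perc_time ?dpath_diam.
Qed.
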